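(* Let $A>2$ be fixed and let $y=y(x)$ satisfy $c_1(\log x)^A\leqslant y\leqslant c_2(\log x)^A$ for some constants $c_2\geqslant c_1>0$ (and $2\leqslant y\leqslant x$). Then \[ |\mathcal{S}(x,y)+\mathcal{S}(x,y)|\leqslant \Psi(x,y)^{\frac{A}{A-1}+o(1)}\qquad(x\to\infty). \]
   Context: For real $x\geqslant y\geqslant 2$, $\mathcal{S}(x,y)=\{n\in\mathbb{Z}_{\geqslant 1} : n\leqslant x,\ P^+(n)\leqslant y\}$, where $P^+(n)$ denotes the largest prime factor of an integer $n\geqslant 2$ and $P^+(1)=1$, and $\Psi(x,y)=|\mathcal{S}(x,y)|$. For a set $\mathcal{A}$ of integers, $\mathcal{A}+\mathcal{A}=\{a+a' : a,a'\in\mathcal{A}\}$. $\log$ is the natural logarithm; the $o(1)$ term tends to $0$ as $x\to\infty$. *)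

(* Defs.v *)
From HB Require Import structures.
From mathcomp Require Import all_boot all_order all_algebra finmap.
From mathcomp Require Import all_classical all_reals all_analysis.

Set Implicit Arguments.
Unset Strict Implicit.
Unset Printing Implicit Defensive.

Import Order.TTheory GRing.Theory Num.Theory.
Import numFieldNormedType.Exports.

Local Open Scope classical_set_scope.
Local Open Scope ring_scope.

(* [max_pdiv n] is the largest prime factor of [n] for [n >= 2], and
   [max_pdiv 1 = 1]. *)
Definition smooth (R : realType) (x y : R) : set nat :=
  [set n : nat | [/\ (1 <= n)%N, n%:R <= x & (max_pdiv n)%:R <= y]].

Definition sumset (A : set nat) : set nat :=
  [set (a + a')%N | a in A & a' in A].

(* The cardinality of an infinite set is 0 here; [finite_smooth] and
   [finite_sumset] show that this does not occur for the sets of interest. *)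
Definition card_set (A : set nat) : nat := #|` fset_set A|%fset.

Definition Psi (R : realType) (x y : R) : nat := card_set (smooth x y).

Lemma finite_smooth (R : realType) (x y : R) : finite_set (smooth x y).
Proof.
apply: (@sub_finite_set _ _ `I_(Num.bound x).+1); last exact: finite_II.
move=> n [_ nx _] /=; rewrite ltnS ltnW // -(ltr_nat R).
by apply: (le_lt_trans nx); apply: archi_boundP; exact: le_trans nx.
Qed.

Lemma finite_sumset (A : set nat) : finite_set A -> finite_set (sumset A).
Proof. by move=> fA; exact: finite_image2. Qed.

(* Main.v *)
(* Trivially |S + S| <= 3 x, so it suffices that Psi(x, y) >= x^(1 - 1/A - o(1)).
   Let k be the number of primes up to y and u = floor(log x / log y).  The
   products of u distinct primes up to y are distinct smooth integers, whence
   Psi(x, y) >= C(k, u) >= ((k - u) / u)^u.  Chebyshev's lower bound, obtained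
   from 2^n <= C(2n, n) <= (2n)^pi(2n), gives k >= (log x)^(A - o(1)), while
   u <= log x, so that Psi(x, y) >= (log x)^((A - 1 - o(1)) u), and
   u log log x = (1/A + o(1)) log x. *)
Require Import Defs.
From HB Require Import structures.
From mathcomp Require Import all_boot all_order all_algebra finmap.
From mathcomp Require Import all_classical all_reals all_analysis.
From mathcomp Require Import zify ring lra.
Import Order.TTheory GRing.Theory Num.Theory.
Import numFieldNormedType.Exports.
Local Open Scope classical_set_scope.
Local Open Scope ring_scope.

(** * Central binomial coefficients and the number of primes *)

(** By symmetry and Pascal's rule, C(2n+2, n+1) = 2 C(2n+1, n) >= 2 C(2n, n). *)
Lemma leq_exp2_bin_double n : (2 ^ n <= 'C(n.*2, n))%N.
Proof.
elim: n => // n IHn.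
have sym_bin : 'C(n.*2.+1, n.+1) = 'C(n.*2.+1, n).
  rewrite -[RHS]bin_sub ?leqW -?addnn ?leq_addr //.
  by congr binomial; lia.
rewrite expnS doubleS binS sym_bin addnn -mul2n leq_mul2l /=.
case: n IHn {sym_bin} => // n IHn.
by rewrite binS; exact: leq_trans IHn (leq_addr _ _).
Qed.

Lemma expn_logn_bin_double_leq p n :
  prime p -> (0 < n)%N -> (p ^ logn p 'C(n.*2, n) <= n.*2)%N.
Proof.
move=> p_pr n_gt0; have p_gt1 := prime_gt1 p_pr.
have n2_gt0 : (0 < n.*2)%N by rewrite double_gt0.
(* Legendre: each term [2n %/ p^k - 2 (n %/ p^k)] is at most 1, and it vanishes
   once [p^k > 2n]. *)
suff le_logn : (logn p 'C(n.*2, n) <= trunc_log p n.*2)%N.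
  by apply: leq_trans (trunc_logP p_gt1 n2_gt0); rewrite leq_exp2l.
have le_n : (n <= n.*2)%N by rewrite -addnn leq_addr.
have := congr1 (logn p) (bin_fact le_n).
have -> : (n.*2 - n)%N = n by rewrite -addnn addnK.
rewrite !lognM ?muln_gt0 ?fact_gt0 ?bin_gt0 //.
(* Legendre's sum for [n] is padded with zero terms up to [n.*2], so that all the sums share one
   range. *)
have -> : logn p n`! = (\sum_(1 <= k < n.*2.+1) n %/ p ^ k)%N.
  rewrite logn_fact // (@big_cat_nat _ _ _ n.+1 1 n.*2.+1) //=.
  rewrite [X in (_ = _ + X)%N]big_nat [X in (_ = _ + X)%N]big1 ?addn0 // => i /andP[lt_ni _].
  by rewrite divn_small // (leq_trans lt_ni) // ltnW // ltn_expl.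
rewrite logn_fact // => eq_logn.
suff : (\sum_(1 <= k < n.*2.+1) n.*2 %/ p ^ k <=
    trunc_log p n.*2 +
    (\sum_(1 <= k < n.*2.+1) n %/ p ^ k + \sum_(1 <= k < n.*2.+1) n %/ p ^ k))%N.
  by rewrite -eq_logn leq_add2r.
have le_log : (trunc_log p n.*2 <= n.*2)%N.
  by apply: leq_trans (trunc_logP p_gt1 n2_gt0); rewrite ltnW // ltn_expl.
(* [trunc_log p n.*2] becomes a sum of ones over its range, for a termwise comparison. *)
rewrite -big_split /= -[X in (_ <= X + _)%N](@subn1 _.+1).
rewrite -[X in (_ <= X + _)%N]muln1 -sum_nat_const_nat.
rewrite (@big_cat_nat _ _ _ (trunc_log p n.*2).+1 1 n.*2.+1) //=.
rewrite [X in (_ <= _ + X)%N](@big_cat_nat _ _ _ (trunc_log p n.*2).+1 1 n.*2.+1) //=.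
rewrite addnA leq_add //; last first.
  rewrite big_nat [leqLHS]big1 // => i /andP[lt_i _].
  by rewrite divn_small // (leq_trans (trunc_log_ltn _ p_gt1)) // leq_exp2l.
rewrite -big_split /= leq_sum // => i _.
have p_gt0 : (0 < p ^ i)%N by rewrite expn_gt0 ltnW.
rewrite -addnn.
have := divn_eq n (p ^ i); have := ltn_pmod n p_gt0.
set q := (n %/ p ^ i)%N; set r := (n %% p ^ i)%N; move: (p ^ i)%N p_gt0 => d d_gt0 lt_rd ->.
rewrite -ltnS ltn_divLR //; nia.
Qed.

(** Primes are kept as a finite set of ordinals so that [cards_draws] can count its [u]-subsets. *)
Definition prime_count n := #|[set p : 'I_n.+1 | prime p]%SET|.

(** Each prime power exactly dividing the coefficient is at most [n.*2]; hence so is each prime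
    divisor, which bounds the number of factors. *)
Lemma bin_double_leq_exp n : (0 < n)%N ->
  ('C(n.*2, n) <= n.*2 ^ prime_count n.*2)%N.
Proof.
move=> n_gt0; have n2_gt0 : (0 < n.*2)%N by rewrite double_gt0.
have le_n : (n <= n.*2)%N by rewrite -addnn leq_addr.
have bin_gt : (0 < 'C(n.*2, n))%N by rewrite bin_gt0.
rewrite {1}(prod_prime_decomp bin_gt) prime_decompE big_map /=.
apply: (@leq_trans (\prod_(p <- primes 'C(n.*2, n)) n.*2)%N).
  rewrite big_seq [leqRHS]big_seq; apply: leq_prod => p.
  by rewrite mem_primes => /and3P[p_pr _ _]; exact: expn_logn_bin_double_leq.
rewrite big_const_seq count_predT iter_muln_1 leq_pexp2l //.
rewrite /prime_count cardE -(size_map val).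
apply: uniq_leq_size (primes_uniq _) _ => p p_bin; move: (p_bin).
rewrite mem_primes => /and3P[p_pr _ _].
have lt_p : (p < n.*2.+1)%N.
  rewrite ltnS (leq_trans _ (expn_logn_bin_double_leq _ _ p_pr n_gt0)) //.
  by rewrite -[leqLHS]expn1 leq_exp2l ?prime_gt1 // logn_gt0.
by apply/mapP; exists (Ordinal lt_p); rewrite // mem_enum inE.
Qed.

(** * Smooth integers as products of distinct primes *)

(** Each factor of the falling factorial [k ^_ u] is at least [k - u], and u! <= u^u. *)
Lemma exp_leq_bin k u : ((k - u) ^ u <= u ^ u * 'C(k, u))%N.
Proof.
have le_fact : (u`! <= u ^ u)%N.
  have -> : (u ^ u = \prod_(1 <= i < u.+1) u)%N.
    by rewrite prod_nat_const_nat subn1.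
  rewrite fact_prod.
  by rewrite big_nat [leqRHS]big_nat; apply: leq_prod => i; rewrite ltnS => /andP[].
apply: (@leq_trans (k ^_ u)).
  rewrite ffact_prod -[X in (_ ^ X <= _)%N]card_ord -prod_nat_const.
  by apply: leq_prod => i _; rewrite leq_sub2l // ltnW.
by rewrite -bin_ffact mulnC leq_mul2r le_fact orbT.
Qed.

Lemma bin_prime_count_leq_Psi (R : realType) (x y : R) (N u : nat) :
    (0 < N)%N -> (N ^ u)%:R <= x -> N%:R <= y ->
  ('C(prime_count N, u) <= Psi x y)%N.
Proof.
move=> N_gt0 Nu_x N_y.
pose P := [set p : 'I_N.+1 | prime p]%SET.
pose D := [set B : {set 'I_N.+1} | B \subset P & #|B| == u]%SET.
pose f (B : {set 'I_N.+1}) := (\prod_(p in B) p)%N.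
have prime_in B p : B \in D -> p \in B -> prime p.
  by rewrite inE => /andP[/fintype.subsetP sBP _] /sBP; rewrite inE.
(* The prime divisors of [f B] are the elements of [B]: this gives both injectivity and
   smoothness. *)
have dvd_f B p : B \in D -> prime p -> (p %| f B)%N = [exists q in B, p == q :> nat].
  move=> DB p_pr; rewrite Euclid_dvd_prod // big_has_cond.
  apply/hasP/exists_inP => [[q _ /andP[Bq]]|[q Bq /eqP->]].
    by rewrite dvdn_prime2 ?(prime_in B) //; exists q.
  by exists q; rewrite ?mem_index_enum //= Bq dvdnn.
have f_inj : {in D &, injective f}.
  suff sub B C : B \in D -> C \in D -> f B = f C -> B \subset C.
    by move=> B C DB DC eqf; apply/eqP; rewrite finset.eqEsubset !sub.
  move=> DB DC eqf; apply/fintype.subsetP => p Bp; have p_pr := prime_in _ _ DB Bp.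
  have : (p %| f B)%N by rewrite dvd_f //; apply/exists_inP; exists p.
  by rewrite eqf dvd_f // => /exists_inP[q Cq /eqP/val_inj->].
rewrite -cards_draws -/P -/D cardE -(size_map f).
have uniq_f : uniq [seq f B | B <- enum D].
  rewrite map_inj_in_uniq ?enum_uniq // => B C.
  by rewrite !mem_enum; exact: f_inj.
apply: uniq_leq_size uniq_f _ => _ /mapP[B + ->].
rewrite mem_enum => DB; rewrite in_fset_set; last exact: finite_smooth.
have f_gt0 : (0 < f B)%N.
  by rewrite prodn_cond_gt0 // => p Bp; rewrite prime_gt0 // (prime_in B).
rewrite inE; split=> //.
  apply: le_trans Nu_x; rewrite ler_nat.
  have /eqP <- : #|B| == u by move: DB; rewrite inE => /andP[].
  by rewrite -prod_nat_const leq_prod // => p _; rewrite -ltnS.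
apply: le_trans N_y; rewrite ler_nat.
(* The empty product is apart, since [max_pdiv 1 = 1] is not prime. *)
have [f_gt1|] := ltnP 1 (f B); last first.
  by move=> f_le1; apply: leq_trans (leq_trans f_le1 N_gt0); exact: max_pdiv_leq.
have := max_pdiv_dvd (f B); rewrite dvd_f ?max_pdiv_prime //.
by case/exists_inP => q _ /eqP ->; rewrite -ltnS.
Qed.

(** * Chebyshev's lower bound at a real argument *)

Lemma ln2_ge (R : realType) : 2^-1 <= ln 2 :> R.
Proof.
have : ln (1 + - 2^-1) <= - 2^-1 :> R by apply: le_ln1Dx; lra.
have -> : 1 + - 2^-1 = 2^-1 :> R by field.
by rewrite lnV ?posrE // lerN2.
Qed.

(** Take for [N] the largest even integer 2n <= y. Then n ln 2 <= pi(2n) ln(2n), where n > y/2 - 1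
    >= y/4 and ln 2 >= 1/2. *)
Lemma prime_count_ge (R : realType) (y : R) : 4 <= y ->
  exists N : nat, [/\ (0 < N)%N, N%:R <= y & y / 8 <= (prime_count N)%:R * ln y].
Proof.
move=> y_ge4; pose n := (Num.truncn y)./2.
have y_ge0 : 0 <= y by lra.
have /andP[trunc_y y_trunc] := truncn_itv y_ge0.
have n2_le : (n.*2 <= Num.truncn y)%N by rewrite /n; lia.
have n2_ge : (Num.truncn y <= n.*2.+1)%N by rewrite /n; lia.
have y_lt : y < 2 * n%:R + 2.
  apply: (lt_le_trans y_trunc); rewrite -natrM -natrD ler_nat; lia.
have n_gt0 : (0 < n)%N.
  rewrite lt0n; apply/eqP => n0; move: y_lt; rewrite n0; lra.
have N_y : n.*2%:R <= y by apply: le_trans trunc_y; rewrite ler_nat.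
exists n.*2; split; rewrite ?double_gt0 //.
have ln_le : n%:R * ln 2 <= (prime_count n.*2)%:R * ln n.*2%:R :> R.
  rewrite !mulr_natl -!lnXn ?ltr0n ?double_gt0 // ler_ln ?posrE ?exprn_gt0 ?ltr0n ?double_gt0 //.
  rewrite -!natrX ler_nat; apply: leq_trans (leq_exp2_bin_double n) _.
  exact: bin_double_leq_exp.
have ln_mono : ln n.*2%:R <= ln y :> R.
  by rewrite ler_ln ?posrE ?ltr0n ?double_gt0 //; lra.
have k_ge0 : 0 <= (prime_count n.*2)%:R :> R by exact: ler0n.
have := ln2_ge R; nra.
Qed.

(** * Growth estimates in the variable ln ln x *)

Lemma expR_ge_sqr (R : realType) (s : R) : 0 <= s -> s ^+ 2 / 4 <= expR s.
Proof.
move=> s_ge0; have -> : s = s / 2 + s / 2 by field.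
have le_half : s / 2 <= expR (s / 2) by have := expR_ge1Dx (s / 2); lra.
rewrite expRD; apply: le_trans (ler_pM _ _ le_half le_half); rewrite ?divr_ge0 //.
by rewrite le_eqVlt; apply/orP; left; apply/eqP; field.
Qed.

Lemma near_linear_le_expR (R : realType) (K a : R) : 0 < a ->
  \forall t \near +oo, K * t <= expR (a * t).
Proof.
move=> a_gt0; near=> t.
have t_ge0 : 0 <= t by near: t; by apply: nbhs_pinfty_ge; exact: num_real.
have t_ge : 4 * K / a ^+ 2 <= t by near: t; by apply: nbhs_pinfty_ge; exact: num_real.
apply: le_trans (expR_ge_sqr _ _ (mulr_ge0 (ltW a_gt0) t_ge0)).
move: t_ge; rewrite ler_pdivrMr ?exprn_gt0 //; nra.
Unshelve. all: by end_near. Qed.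

Lemma near_ln_ln (R : realType) (P : R -> Prop) :
  (\forall t \near +oo, P t) ->
  \forall x \near +oo, 0 < ln x /\ P (ln (ln x)).
Proof.
case=> M [_ MP]; near=> x.
have x_gt : expR (expR M) < x by near: x; by apply: nbhs_pinfty_gt; exact: num_real.
have x_gt0 : 0 < x by apply: lt_trans x_gt; exact: expR_gt0.
have lnx_gt : expR M < ln x by rewrite -(expRK (expR M)) ltr_ln ?posrE ?expR_gt0.
have lnx_gt0 : 0 < ln x by apply: lt_trans lnx_gt; exact: expR_gt0.
by split=> //; apply: MP; rewrite -(expRK M) ltr_ln ?posrE ?expR_gt0.
Unshelve. all: by end_near. Qed.

(** * Lower bound for ln Psi *)

(** Here [g] is any exponent below 1 - 1/A, and the threshold on [x] is uniform in [y]. *)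
Lemma near_ln_Psi_ge (R : realType) (A c1 c2 g : R) :
    2 < A -> 0 < c1 -> 0 < c2 -> g * A < A - 1 ->
  \forall x \near +oo, forall y,
    c1 * (ln x) `^ A <= y <= c2 * (ln x) `^ A -> g * ln x <= ln (Psi x y)%:R.
Proof.
move=> A_gt2 c1_gt0 c2_gt0 gA.
(* [d] is the loss allowed in the exponents, with [t = ln (ln x)] below:
   [y <= expR ((A + d) * t)] and [2 * expR ((A - d) * t) <= k]. *)
have [d [d_gt0 d_le1 gd]] : exists d : R, [/\ 0 < d, d <= 1 &
    (g + d) * (A + d) <= A - 1 - d].
  have e_gt0 : 0 < (A - 1 - g * A) / (A + 4) by rewrite divr_gt0 //; lra.
  have eE : (A - 1 - g * A) / (A + 4) * (A + 4) = A - 1 - g * A.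
    by rewrite divfK //; lra.
  have g_lt1 : g < 1 by nra.
  (* As [g < 1] and [d <= 1], passing from g A <= A - 1 to the goal costs at most (A + 3) d. *)
  exists (Num.min 1 ((A - 1 - g * A) / (A + 4))).
  set e := _ / _ in e_gt0 eE *.
  by have [?|?] := leP 1 e; split; nra.
(* The constant 16 is the 8 of [prime_count_ge] times the 2 wanted in [k_ge2]; the last condition
   absorbs the rounding of [u]. *)
have : \forall t \near +oo, [/\ 1 <= t, c2 <= expR (d * t),
    16 * (A + d) * t <= c1 * expR (d * t) & (A - 1) * t <= d * expR t].
  near=> t.
  have t_ge1 : 1 <= t by near: t; by apply: nbhs_pinfty_ge; exact: num_real.
  split=> //.
  - have : c2 * t <= expR (d * t) by near: t; exact: near_linear_le_expR.
    nra.
  - have : 16 * (A + d) / c1 * t <= expR (d * t).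
      by near: t; exact: near_linear_le_expR.
    rewrite -(ler_pM2l c1_gt0); congr (_ <= _); field; lra.
  - have : (A - 1) / d * t <= expR (1 * t).
      by near: t; exact: near_linear_le_expR.
    rewrite mul1r -(ler_pM2l d_gt0); congr (_ <= _); field; lra.
move=> /near_ln_ln; apply: filterS => x [L_gt0].
set L := ln x in L_gt0 *; set t := ln L; move=> [t_ge1 c2_le c1_ge t_le].
have LE : expR t = L by rewrite lnK.
have x_gt0 : 0 < x.
  by rewrite ltNge; apply: contraTN L_gt0 => /ln0 lnx0; rewrite /L lnx0 ltxx.
have xE : expR L = x by rewrite lnK.
have powE : L `^ A = expR (A * t) by rewrite /powR gt_eqF.
move=> y; rewrite powE => /andP[y_ge y_le].
have expA_ge : expR (d * t) <= expR (A * t) by rewrite ler_expR; nra.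
have y_ge16 : 16 <= y by nra.
have y_gt0 : 0 < y by lra.
set a := ln y; have yE : expR a = y by rewrite lnK.
have a_ge1 : 1 <= a.
  have := ln2_ge R; have : ln (2 ^+ 4) <= a.
    by rewrite ler_ln ?posrE ?exprn_gt0 //; lra.
  rewrite lnXn //; lra.
have a_le : a <= (A + d) * t.
  rewrite -ler_expR yE mulrDl expRD; apply: (le_trans y_le).
  by rewrite mulrC ler_pM2l ?expR_gt0.
have [|N [N_gt0 N_le]] := prime_count_ge _ y; first lra.
set k := prime_count N => k_ge; rewrite -/a in k_ge.
set E := expR ((A - d) * t).
(* k a >= y/8 >= 2 (A + d) t E >= 2 a E. The factor 2 leaves k - u >= E once u <= E. *)
have k_ge2 : 2 * E <= k%:R.
  have cE : c1 * expR (A * t) = c1 * expR (d * t) * E.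
    by rewrite -mulrA -expRD; congr (_ * expR _); ring.
  have E_gt0 : 0 < E by exact: expR_gt0.
  have : 16 * (A + d) * t * E <= y.
    by apply: le_trans y_ge; rewrite cE ler_pM2r.
  have : a * E <= (A + d) * t * E by rewrite ler_pM2r.
  rewrite -(@ler_pM2r _ a); last lra.
  nra.
have La_ge0 : 0 <= L / a by rewrite divr_ge0 //; lra.
set u := Num.truncn (L / a); have /andP[u_le u_gt] := truncn_itv La_ge0.
rewrite -/u in u_le u_gt.
have ua_le : u%:R * a <= L by rewrite -ler_pdivlMr //; lra.
have u_ge0 : 0 <= u%:R :> R by exact: ler0n.
have u_leL : u%:R <= expR t by rewrite LE; nra.
have u_leE : u%:R <= E by apply: (le_trans u_leL); rewrite ler_expR; nra.
have Psi_ge := bin_prime_count_leq_Psi R x y N u N_gt0 _ N_le.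
have {}Psi_ge : ('C(k, u) <= Psi x y)%N.
  apply: Psi_ge; rewrite natrX -xE; apply: (@le_trans _ _ (expR a ^+ u)).
    by rewrite yE lerXn2r ?nnegrE //; lra.
  by rewrite -expRM_natl ler_expR.
have E_gt0 : 0 < E by exact: expR_gt0.
have le_uk : (u <= k)%N by rewrite -(ler_nat R); lra.
(* E^u <= (k - u)^u <= u^u Psi, and u^u <= expR (t u) is cancelled. *)
have main : expR ((A - 1 - d) * t * u%:R) <= (Psi x y)%:R.
  rewrite -(@ler_pM2l _ (expR (t * u%:R))) ?expR_gt0 // -expRD.
  have -> : t * u%:R + (A - 1 - d) * t * u%:R = (A - d) * t * u%:R by ring.
  rewrite !(mulrC _ u%:R) !expRM_natl -/E.
  apply: (@le_trans _ _ ((k - u)%N%:R ^+ u)).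
    by rewrite lerXn2r ?nnegrE ?expR_ge0 // natrB //; lra.
  apply: (@le_trans _ _ (u%:R ^+ u * (Psi x y)%:R)).
    rewrite -!natrX -natrM ler_nat (leq_trans (exp_leq_bin _ _)) //.
    by rewrite leq_mul2l Psi_ge orbT.
  by rewrite ler_wpM2r // lerXn2r ?nnegrE ?expR_ge0.
have Psi_gt0 : 0 < (Psi x y)%:R :> R by apply: lt_le_trans main; exact: expR_gt0.
have : (A - 1 - d) * t * u%:R <= ln (Psi x y)%:R.
  by rewrite -ler_expR lnK.
apply: le_trans.
(* Replacing L / a by its floor [u] loses one term (A - 1 - d) (A + d) t, which [H3] pays for with
   the spare d (A + d) L of [H2]. *)
have Lt : L <= (u%:R + 1) * ((A + d) * t).
  have : L <= (u%:R + 1) * a by rewrite -ler_pdivrMr ?natr1 ?ltW //; lra.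
  nra.
have H1 : (A - 1 - d) * L <= (A - 1 - d) * ((u%:R + 1) * ((A + d) * t)).
  by rewrite ler_wpM2l //; lra.
have H2 : (g + d) * (A + d) * L <= (A - 1 - d) * L by rewrite ler_wpM2r // ltW.
have H3 : (A - 1 - d) * t * (A + d) <= d * L * (A + d).
  rewrite ler_wpM2r //; first lra.
  by rewrite -LE; nra.
have Ad_gt0 : 0 < A + d by lra.
by rewrite -(ler_pM2r Ad_gt0); lra.
Unshelve. all: by end_near. Qed.

(** * The trivial bound on the sumset, and the conclusion *)

Lemma card_sumset_smooth_le (R : realType) (x y : R) : 1 <= x ->
  (card_set (sumset (smooth x y)))%:R <= 3 * x.
Proof.
move=> x_ge1; have x2_ge0 : 0 <= 2 * x by lra.
have /andP[trunc_le _] := truncn_itv x2_ge0.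
apply: (@le_trans _ _ (Num.truncn (2 * x)).+1%:R); last by rewrite -natr1; lra.
rewrite ler_nat; apply/geq_card_fset_set/subset_card_le.
move=> _ [a [_ a_x _] [b [_ b_x _] <-]] /=.
by rewrite ltnS truncn_ge_nat // natrD; lra.
Qed.

(** Makes ln Psi positive, so that one can divide by it in the exponent. *)
Lemma Psi_gt1 (R : realType) (x y : R) : 2 <= y -> 2 <= x -> (1 < Psi x y)%N.
Proof.
move=> y_ge2 x_ge2; have <- : #|` [fset 1%N; 2%N]%fset| = 2%N by rewrite cardfs2.
apply: fsubset_leq_card; apply/fsubsetP => n.
rewrite in_fset_set; last exact: finite_smooth.
have max_pdiv1 : max_pdiv 1 = 1%N by [].
by rewrite !inE => /orP[]/eqP->; split=> //; rewrite ?max_pdiv1; lra.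
Qed.

Theorem theorem8 (R : realType) (A c1 c2 x0 : R) (y : R -> R)
    (hA : 2 < A) (hc1 : 0 < c1) (hc12 : c1 <= c2)
    (hy : forall x : R, x0 <= x ->
       c1 * (ln x) `^ A <= y x <= c2 * (ln x) `^ A)
    (hyx : forall x : R, x0 <= x -> 2 <= y x <= x) :
  exists o : R -> R,
    o x @[x --> +oo] --> (0 : R) /\
    forall x : R, x0 <= x ->
      (card_set (sumset (smooth x (y x))))%:R
        <= (Psi x (y x))%:R `^ (A / (A - 1) + o x).
Proof.
(* [q x] is the exponent for which Psi^(q x) = 3x. *)
pose q x := ln (3 * x) / ln (Psi x (y x))%:R.
have c2_gt0 : 0 < c2 by lra.
(* Truncating at 0 makes a lower bound for [Psi] alone enough for [o] to
   vanish. *)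
exists (fun x => Num.max 0 (q x - A / (A - 1))); split.
  apply/cvgrPdist_le => e e_gt0.
  pose r := A / (A - 1).
  have rE : r * (A - 1) = A by rewrite divfK //; lra.
  have r_gt1 : 1 < r by nra.
  (* Since 1/g exceeds [r] by e/2, [g] is below 1 - 1/A and ln x / ln Psi <= r + e/2 eventually; the
     other e/2 is for the ln 3 in [q]. *)
  pose g := (r + e / 2)^-1.
  have g_gt0 : 0 < g by rewrite invr_gt0; lra.
  have gE : g * (r + e / 2) = 1 by rewrite mulVf //; lra.
  have gA : g * A < A - 1.
    have gr_lt1 : g * r < 1 by nra.
    have : g * A = g * r * (A - 1) by rewrite -mulrA rE.
    nra.
  have ln3_gt0 : 0 < ln 3 :> R by rewrite ln_gt0 //; lra.
  near=> x.
  have x0_x : x0 <= x by near: x; apply: nbhs_pinfty_ge; exact: num_real.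
  have x_gt1 : 1 < x by near: x; apply: nbhs_pinfty_gt; exact: num_real.
  have Psi_ge : g * ln x <= ln (Psi x (y x))%:R.
    suff : forall y, c1 * (ln x) `^ A <= y <= c2 * (ln x) `^ A ->
        g * ln x <= ln (Psi x y)%:R by apply; exact: hy.
    by near: x; exact: near_ln_Psi_ge.
  have x_gt0 : 0 < x by lra.
  have lnx_gt0 : 0 < ln x by exact: ln_gt0.
  have lnx_ge : 2 * ln 3 / (e * g) <= ln x.
    have x_ge : expR (2 * ln 3 / (e * g)) <= x.
      by near: x; apply: nbhs_pinfty_ge; exact: num_real.
    by rewrite -[leLHS]expRK ler_ln ?posrE ?expR_gt0.
  have q_le : q x <= r + e.
    have lnPsi_gt0 : 0 < ln (Psi x (y x))%:R :> R.
      by apply: lt_le_trans Psi_ge; exact: mulr_gt0.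
    rewrite /q ler_pdivrMr // lnM ?posrE //.
    have : (r + e) * (g * ln x) <= (r + e) * ln (Psi x (y x))%:R.
      by rewrite ler_pM2l //; lra.
    apply: le_trans.
    have -> : (r + e) * (g * ln x) = g * (r + e / 2) * ln x + ln x * (e * g) / 2.
      by field.
    move: lnx_ge; rewrite gE mul1r ler_pdivrMr ?mulr_gt0 //; lra.
  rewrite sub0r normrN ger0_norm ?le_max ?lexx // ge_max ltW //= -/r; lra.
move=> x x0_x; have /andP[y_ge2 y_x] := hyx x x0_x.
have Psi_gt1 : (1 < Psi x (y x))%N.
  by apply: Psi_gt1; lra.
have Psi_gt1R : 1 < (Psi x (y x))%:R :> R by rewrite ltr1n.
have lnPsi_gt0 : 0 < ln (Psi x (y x))%:R :> R by exact: ln_gt0.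
apply: (@le_trans _ _ (3 * x)); first by apply: card_sumset_smooth_le; lra.
apply: (@le_trans _ _ ((Psi x (y x))%:R `^ q x)).
  rewrite /powR gt_eqF ?divfK ?lt0r_neq0 //; last lra.
  by rewrite lnK // posrE; lra.
apply: ler_powR; first exact: ltW.
by rewrite -lerBlDl le_max lexx orbT.
Unshelve. all: by end_near. Qed.
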